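(* Let $n,n'\in\{0,1,2,\dots\}$, let $q\in\mathbb{C}$ with $0<|q|<1$, and let $a\in\mathbb{C}\setminus\{0\}$ with $a^{-2}\notin\Omega_q$. Then the continuous big $q^{-1}$-Hermite polynomials satisfy $$\sum_{m=0}^\infty q^{3\binom m2}\left(-\frac{q}{a^2}\right)^m\frac{(\frac{q}{a^2};q)_{2m}\,(\frac1{a^2};q)_m}{(\frac1{a^2};q)_{2m}\,(q;q)_m}\,H_n[q^{-m}a;a|q^{-1}]\,H_{n'}[q^{-m}a;a|q^{-1}]=\frac{q^{-\binom n2}}{(-q)^n}\left(\frac q{a^2};q\right)_\infty(q;q)_n\,\delta_{n,n'}.$$
   Context: Notation: $(A;p)_n=\prod_{j=0}^{n-1}(1-Ap^j)$ for $p\in\mathbb{C}\setminus\{0\}$; $(A;q)_\infty=\prod_{j\ge0}(1-Aq^j)$; products such as $(A,B,C;p)_k=(A;p)_k(B;p)_k(C;p)_k$. $\Omega_q=\{q^{-k}:k=0,1,2,\dots\}$, $\binom n2=\frac{n(n-1)}2$, $\delta_{n,n'}$ is the Kronecker delta. Continuous big Hermite polynomials: for a base $p\in\mathbb{C}\setminus\{0\}$, $|p|\ne1$, $a,z\in\mathbb{C}\setminus\{0\}$, $x=\frac12(z+z^{-1})$, $$H_n[z;a|p]=H_n(x;a|p)=a^{-n}\sum_{k=0}^n\frac{(p^{-n},az,az^{-1};p)_k}{(p;p)_k}\,p^k .$$ The continuous big $q^{-1}$-Hermite polynomials are $H_n[z;a|q^{-1}]$, i.e. $p=q^{-1}$.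 *)

(* Defs.v *)
From Stdlib Require Import Reals Arith.
From Coquelicot Require Import Coquelicot.

Open Scope C_scope.

(** The shifted factorial [(A;p)_n], for an arbitrary base [p]. *)
Fixpoint qpoch (A p : C) (n : nat) : C :=
  match n with
  | O => 1
  | S j => qpoch A p j * (1 - A * p ^ j)
  end.

(** [(A;q)_oo], the limit of [(A;q)_n] in [C]; it exists when [Cmod q < 1],
    and the value is unspecified when there is no limit. *)
Definition qpoch_inf (A q : C) : C :=
  @iota C_CompleteNormedModule
    (fun l => filterlim (qpoch A q) eventually (locally l)).

Definition Omega (q : C) (w : C) : Prop := exists k : nat, w = / (q ^ k).

Definition binom2 (n : nat) : nat := (n * (n - 1) / 2)%nat.

Definition kdelta (n n' : nat) : C := if Nat.eqb n n' then 1 else 0.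

(** The continuous big Hermite polynomial [H_n[z;a|p]] of degree [n] in
    [x = (z + 1/z)/2], for [a], [z], [p] nonzero and [Cmod p <> 1].
    Note that [sum_n f n] is [f 0 + ... + f n]. *)
Definition big_Hermite (n : nat) (z a p : C) : C :=
  / (a ^ n) *
  sum_n (fun k : nat =>
    (qpoch (/ (p ^ n)) p k * qpoch (a * z) p k * qpoch (a * / z) p k)
    / qpoch p p k * p ^ k) n.

(* Main.v *)
Require Import Defs.
From Stdlib Require Import Reals Arith Lra Lia.
From Coquelicot Require Import Coquelicot.
Open Scope C_scope.

(** The weight of the sum is a very-well-poised term.  With [A = 1 / a ^ 2] put

      t_s(B) = q^(3 binom(s,2)) (-qB)^s (B;q)_s (1 - B q^(2s)) / (q;q)_s,

    so that the weight is [w_m = t_m(A) / (1 - A)] ([weight_qpoch]).  Let [L] be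
    the functional [f |-> sum_m w_m f(m)].

    The terms satisfy [(1 - B) t_s(Bq) = t_s(B) + (V_(s+1) - V_s)] with [V_0 = 0]
    and [V_s -> 0] ([poised_telescope]); hence the sum [G(B)] of the [t_s(B)] equals
    [(B;q)_N G(B q^N)] for every [N].  Since [G(B q^N) -> 1], this yields
    [G(B) = (B;q)_oo] ([poised_series]).

    The polynomials expand in the basis [g_k = (az, a/z; 1/q)_k].  At the nodes
    [z = a q^(-m)] the basis element vanishes for [m < k], and
    [t_(k+s)(A) g_k(k+s) = (A;q)_(2k) t_s(A q^(2k))] ([poised_term_basis]).  The
    functional equation of [G] then gives [L(g_k) = (qA;q)_oo] for every [k]
    ([basis_moment]): [L] acts on polynomials by adding up coefficients.  The
    coefficients of [H_n] add up to [0] when [n >= 1], so [L(H_n) = 0] there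
    ([herm_mean]).

    Finally, with [p = 1/q], the polynomials obey the three-term recurrence

      (z + 1/z) H_n = H_(n+1) + a p^n H_n + (1 - p^n) H_(n-1)

    ([big_Hermite_recurrence]).  As in the easy half of Favard's theorem, this and
    [L(H_n) = 0] for [n >= 1] imply orthogonality, with squared norms
    [h_(n+1) = (1 - p^(n+1)) h_n] ([herm_orthogonality]).  The series met in
    that step converge because they are linear combinations of series already
    summed. *)

(** * Series of complex numbers *)

Local Notation Cseries := (@is_series C_AbsRing C_NormedModule).

(** Equalities produced by generic lemmas live in the carrier of an abstract
    structure; [ring] and [field] recognise them only at type [C]. *)
Local Ltac C_eq := match goal with |- @eq _ ?x ?y => change (@eq C x y) end.

Lemma sum_C_S (f : nat -> C) (n : nat) :
  @eq C (sum_n f (S n)) (sum_n f n + f (S n)).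
Proof. exact (sum_Sn f n). Qed.

Lemma sum_C_0 (f : nat -> C) : @eq C (sum_n f 0) (f O).
Proof. exact (sum_O f). Qed.

Lemma Cseries_unique (f : nat -> C) (l m : C) :
  Cseries f l -> Cseries f m -> l = m.
Proof. exact (filterlim_locally_unique (V := C_NormedModule) (sum_n f) l m). Qed.

Lemma Cseries_plus (f g : nat -> C) (l m : C) :
  Cseries f l -> Cseries g m -> Cseries (fun n => f n + g n) (l + m).
Proof. exact (is_series_plus f g l m). Qed.

Lemma Cseries_scal (c : C) (f : nat -> C) (l : C) :
  Cseries f l -> Cseries (fun n => c * f n) (c * l).
Proof. exact (is_series_scal c f l). Qed.

Lemma is_series_telescope (W : nat -> C) :
  filterlim W eventually (@locally C_NormedModule (RtoC 0)) ->
  Cseries (fun s => W (S s) - W s) (- W O).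
Proof.
  intros H.
  apply (filterlim_ext (fun s => W (S s) + - W O)).
  - induction x as [|x IH].
    + rewrite sum_O. reflexivity.
    + rewrite sum_Sn, <- IH.
      change (W (S (S x)) + - W O = W (S x) + - W O + (W (S (S x)) - W (S x))). ring.
  - apply (filterlim_comp_2 (G := @locally C_NormedModule (RtoC 0))
             (H := @locally C_NormedModule (- W O)) (fun s => W (S s)) (fun _ => - W O) Cplus).
    + apply (filterlim_comp _ _ _ S W _ eventually); [|exact H].
      intros P [N HN]. exists N. intros n Hn. apply HN. lia.
    + apply filterlim_const.
    + pose proof (filterlim_plus (V := C_NormedModule) (RtoC 0) (- W O)) as L.
      replace (plus (RtoC 0 : C_NormedModule) (- W O)) with (- W O) in L; [exact L|].
      change (- W O = 0 + - W O). ring.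
Qed.

Lemma Cseries_skip (f : nat -> C) (l : C) (k : nat) :
  (forall m, (m < k)%nat -> f m = 0) ->
  Cseries (fun s => f (k + s)%nat) l -> Cseries f l.
Proof.
  revert f. induction k as [|k IH]; intros f H0 H; [exact H|].
  apply (is_series_decr_1 (V := C_NormedModule)).
  match goal with |- is_series _ ?x => replace x with l end.
  - apply IH; [|exact H]. intros m Hm. apply H0. lia.
  - rewrite (H0 O) by lia. change (l = l + - 0). ring.
Qed.

Lemma Cmod_series_le (f : nat -> C) (g : nat -> R) (l : C) (m : R) :
  (forall n, (Cmod (f n) <= g n)%R) -> Cseries f l -> is_series g m ->
  (Cmod l <= m)%R.
Proof.
  intros Hfg Hf Hg.
  change (Rbar_le (Cmod l) m).
  apply (is_lim_seq_le (fun n => Cmod (sum_n f n)) (sum_n g)).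
  - intros n. eapply Rle_trans.
    + exact (norm_sum_n_m (V := C_NormedModule) f 0 n).
    + apply sum_n_m_le. exact Hfg.
  - eapply filterlim_comp; [exact Hf|]. exact (filterlim_norm (V := C_NormedModule) l).
  - exact Hg.
Qed.

(** * Shifted factorials *)

Lemma qpoch_S (B p : C) (n : nat) : qpoch B p (S n) = qpoch B p n * (1 - B * p ^ n).
Proof. reflexivity. Qed.

Lemma Cminus_neq0 (x y : C) : x <> y -> x - y <> 0.
Proof.
  intros H E. apply H. replace x with (x - y + y) by ring. rewrite E. ring.
Qed.

(** Peeling the factor of index [0] instead of the last one; this is what relates
    the weights at [A] and at [A * q]. *)
Lemma qpoch_shift (A p : C) (n : nat) :
  (1 - A) * qpoch (A * p) p n = qpoch A p (S n).
Proof.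
  induction n as [|n IH].
  - simpl. ring.
  - change (qpoch (A * p) p (S n)) with (qpoch (A * p) p n * (1 - A * p * p ^ n)).
    rewrite Cmult_assoc, IH.
    change (qpoch A p (S (S n))) with (qpoch A p (S n) * (1 - A * p ^ S n)).
    rewrite Cpow_S. ring.
Qed.

Lemma binom2_S (n : nat) : binom2 (S n) = (binom2 n + n)%nat.
Proof.
  unfold binom2.
  replace (S n * (S n - 1))%nat with (n * (n - 1) + n * 2)%nat by (destruct n; simpl; lia).
  rewrite Nat.div_add by lia. reflexivity.
Qed.

Lemma one_minus_pow_neq0 (q : C) (n : nat) :
  (Cmod q < 1)%R -> 1 - q ^ S n <> 0.
Proof.
  intros Hq. apply Cminus_neq0. intros E.
  assert (H : (Cmod q ^ S n < 1)%R).
  { pose proof (Cmod_ge_0 q). apply pow_lt_1_compat; [lra | lia]. }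
  rewrite <- Cmod_pow, <- E, Cmod_1 in H. lra.
Qed.

Lemma qpoch_neq0 (A p : C) :
  (forall k, 1 - A * p ^ k <> 0) -> forall n, qpoch A p n <> 0.
Proof.
  intros H n. induction n as [|n IH]; simpl.
  - exact C1_nz.
  - apply Cmult_neq_0; auto.
Qed.

(** * The three-term recurrence in a general base *)

Section Recurrence.

Variables (a z p : C).
Hypotheses (Ha : a <> 0) (Hz : z <> 0) (Hp : p <> 0)
  (Hpp : forall k, qpoch p p k <> 0).

(** The basis [(az, a/z; p)_k] of polynomials in [z + 1/z] in which the big
    Hermite polynomials are expanded. *)
Definition askey_basis (k : nat) : C := qpoch (a * z) p k * qpoch (a * / z) p k.

Definition big_coeff (n k : nat) : C := qpoch (/ (p ^ n)) p k / qpoch p p k * p ^ k.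

(** The new pair of factors depends on [z] only through [z + 1/z], linearly; hence
    multiplication by [z + 1/z] is bidiagonal in this basis. *)
Lemma askey_basis_S (k : nat) :
  askey_basis (S k)
  = askey_basis k * (1 - a * (z + / z) * p ^ k + a ^ 2 * (p ^ k * p ^ k)).
Proof.
  unfold askey_basis; simpl qpoch. generalize (p ^ k); intros y. field. auto.
Qed.

Lemma big_coeff_large (n k : nat) : (n < k)%nat -> big_coeff n k = 0.
Proof.
  intros H. unfold big_coeff.
  replace (qpoch (/ p ^ n) p k) with (RtoC 0); [unfold Cdiv; ring|].
  induction H as [|k H IH]; simpl.
  - rewrite Cinv_l by (apply Cpow_nz; auto). ring.
  - rewrite <- IH. ring.
Qed.

Lemma one_minus_pp (k : nat) : 1 - p * p ^ k <> 0.
Proof.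
  intros E. apply (Hpp (S k)). simpl. rewrite E. ring.
Qed.

(** Together with [big_coeff_raise], a q-Pascal rule.  In the recurrence below the
    two rules match the parts with and without a factor [a ^ 2]. *)
Lemma big_coeff_lower (n k : nat) :
  (p ^ k - p ^ n) * big_coeff n k = (1 - p ^ n) * big_coeff (pred n) k.
Proof.
  destruct n as [|n]; simpl pred.
  - destruct k as [|k].
    + simpl. ring.
    + rewrite (big_coeff_large 0 (S k)) by lia. ring.
  - unfold big_coeff.
    assert (E : (p ^ k - p ^ S n) * qpoch (/ p ^ S n) p k
                = (1 - p ^ S n) * qpoch (/ p ^ n) p k).
    { pose proof (qpoch_shift (/ p ^ S n) p k) as H.
      replace (/ p ^ S n * p) with (/ p ^ n) in H.
      2:{ rewrite Cpow_S. field. split; auto using Cpow_nz. }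
      replace (1 - p ^ S n) with (- p ^ S n * (1 - / p ^ S n)).
      2:{ field. apply Cpow_nz; auto. }
      rewrite <- Cmult_assoc, H.
      change (qpoch (/ p ^ S n) p (S k))
        with (qpoch (/ p ^ S n) p k * (1 - / p ^ S n * p ^ k)).
      pose proof (Cpow_nz p (S n) Hp).
      generalize dependent (p ^ S n). intros. field. auto. }
    unfold Cdiv. rewrite !Cmult_assoc, E. ring.
Qed.

Lemma big_coeff_raise (n k : nat) :
  big_coeff n (S k) / p ^ S k - big_coeff n k / p ^ k = big_coeff (S n) (S k).
Proof.
  unfold big_coeff.
  pose proof (qpoch_shift (/ p ^ S n) p k) as H.
  replace (/ p ^ S n * p) with (/ p ^ n) in H.
  2:{ rewrite Cpow_S. field. split; auto using Cpow_nz. }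
  rewrite <- H. simpl qpoch.
  rewrite !Cpow_S.
  pose proof (Cpow_nz p k Hp). pose proof (Cpow_nz p n Hp).
  pose proof (one_minus_pp k). pose proof (Hpp k).
  generalize dependent (p ^ k). generalize dependent (p ^ n). intros.
  field. repeat split; auto.
Qed.

(** The coefficients are differences by [big_coeff_raise], so the sum telescopes
    to a boundary term of index beyond the degree. *)
Lemma sum_big_coeff_S (n : nat) :
  @eq C (sum_n (fun k => big_coeff (S n) k) (S n)) 0.
Proof.
  assert (H : forall N, @eq C (sum_n (fun k => big_coeff (S n) k) N) (big_coeff n N / p ^ N)).
  { induction N as [|N IH].
    - rewrite sum_C_0. unfold big_coeff; simpl. field.
    - rewrite sum_C_S, IH, <- big_coeff_raise. ring. }
  rewrite H, big_coeff_large by lia. unfold Cdiv. ring.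
Qed.

(** The cut-off [N] is kept independent of the degree, so that the polynomials of
    degree [n - 1], [n] and [n + 1] can be summed over one common range. *)
Definition partial_Hermite (n N : nat) : C :=
  sum_n (fun k => big_coeff n k * askey_basis k) N.

Lemma partial_Hermite_stable (n N : nat) :
  (n <= N)%nat -> partial_Hermite n N = partial_Hermite n n.
Proof.
  induction 1 as [|N H IH]; [reflexivity|].
  unfold partial_Hermite in *. rewrite sum_C_S, IH, big_coeff_large by lia. ring.
Qed.

Lemma big_Hermite_partial (n N : nat) :
  (n <= N)%nat -> big_Hermite n z a p = / a ^ n * partial_Hermite n N.
Proof.
  intros H. rewrite partial_Hermite_stable by exact H.
  unfold big_Hermite, partial_Hermite. f_equal.
  apply (sum_n_ext (G := C_AbelianGroup)). intros k.
  unfold big_coeff, askey_basis, Cdiv.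
  C_eq. ring.
Qed.

(** Multiplication by [z + 1/z] sends the basis element of index [k] to those of
    index [k] and [k + 1]; cutting the sums at [N] leaves a single boundary term,
    which vanishes once [N] exceeds [n]. *)
Lemma partial_Hermite_recurrence (n N : nat) :
  a * (z + / z) * partial_Hermite n N
  = partial_Hermite (S n) N + a ^ 2 * p ^ n * partial_Hermite n N
    + a ^ 2 * (1 - p ^ n) * partial_Hermite (pred n) N
    - big_coeff n N / p ^ N * askey_basis (S N).
Proof.
  unfold partial_Hermite. induction N as [|N IH].
  - rewrite !sum_C_0. unfold big_coeff, askey_basis; simpl. field. auto.
  - rewrite !sum_C_S, !(Cmult_plus_distr_l (_ * _)), IH.
    rewrite <- (big_coeff_raise n N), (askey_basis_S (S N)).
    rewrite <- !(Cmult_assoc (a ^ 2) (1 - p ^ n)).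
    rewrite (Cmult_assoc (1 - p ^ n) (big_coeff (pred n) (S N))), <- big_coeff_lower.
    pose proof (Cpow_nz p (S N) Hp). pose proof (Cpow_nz p N Hp).
    generalize dependent (p ^ S N). generalize dependent (p ^ N). intros. field. auto.
Qed.

(** At [n = 0] the truncated predecessor is harmless: its coefficient [1 - p ^ n]
    is zero. *)
Lemma big_Hermite_recurrence (n : nat) :
  (z + / z) * big_Hermite n z a p
  = big_Hermite (S n) z a p + a * p ^ n * big_Hermite n z a p
    + (1 - p ^ n) * big_Hermite (pred n) z a p.
Proof.
  rewrite (big_Hermite_partial n (S n)), (big_Hermite_partial (S n) (S n)),
    (big_Hermite_partial (pred n) (S n)) by lia.
  pose proof (partial_Hermite_recurrence n (S n)) as H.
  rewrite (big_coeff_large n (S n)) in H by lia.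
  assert (E : / a ^ S n * (a ^ 2 * (1 - p ^ n)) = (1 - p ^ n) * / a ^ pred n).
  { destruct n as [|n].
    - simpl. field. auto.
    - simpl pred. rewrite !Cpow_S. pose proof (Cpow_nz a n Ha).
      generalize dependent (a ^ n). intros. field. auto. }
  rewrite (Cmult_assoc (1 - p ^ n)), <- E.
  transitivity (/ a ^ S n * (a * (z + / z) * partial_Hermite n (S n))).
  - rewrite Cpow_S. pose proof (Cpow_nz a n Ha). field. auto.
  - rewrite H. rewrite Cpow_S. pose proof (Cpow_nz a n Ha). pose proof (Cpow_nz p (S n) Hp).
    generalize dependent (p ^ S n). intros. field. auto.
Qed.

End Recurrence.

(** * The very-well-poised sum *)

(** The terms of the limiting very-well-poised series, without their
    very-well-poised factor [1 - B q^(2s)]. *)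
Definition poised_core (q B : C) (s : nat) : C :=
  q ^ (3 * binom2 s) * (- (q * B)) ^ s * qpoch B q s / qpoch q q s.

Definition poised_term (q B : C) (s : nat) : C :=
  poised_core q B s * (1 - B * q ^ (2 * s)).

Section Terms.

Variable q : C.
Hypothesis (Hq : (0 < Cmod q < 1)%R).

Lemma base_neq0 : q <> 0.
Proof. apply Cmod_gt_0. tauto. Qed.

Lemma qq_neq0 (n : nat) : qpoch q q n <> 0.
Proof.
  apply qpoch_neq0. intros k. rewrite <- Cpow_S. apply one_minus_pow_neq0. tauto.
Qed.

Lemma poised_core_S (B : C) (s : nat) :
  (1 - q ^ S s) * poised_core q B (S s)
  = - (q * B) * (q ^ s * (q ^ s * q ^ s)) * (1 - B * q ^ s) * poised_core q B s.
Proof.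
  unfold poised_core.
  replace (3 * binom2 (S s))%nat with (3 * binom2 s + (s + (s + s)))%nat
    by (rewrite binom2_S; lia).
  rewrite !Cpow_add_r. simpl qpoch. rewrite !Cpow_S.
  assert (H : 1 - q * q ^ s <> 0)
    by (rewrite <- Cpow_S; apply one_minus_pow_neq0; tauto).
  pose proof (qq_neq0 s).
  generalize dependent (q ^ s). generalize (q ^ (3 * binom2 s)) ((- (q * B)) ^ s).
  intros. field. auto.
Qed.

Lemma poised_core_shift (B : C) (s : nat) :
  (1 - B) * poised_core q (B * q) s = q ^ s * (1 - B * q ^ s) * poised_core q B s.
Proof.
  unfold poised_core, Cdiv.
  replace (- (q * (B * q))) with (q * (- (q * B))) by ring.
  rewrite (Cpow_mult_l q).
  pose proof (qpoch_shift B q s) as H. simpl in H.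
  transitivity (q ^ (3 * binom2 s) * (q ^ s * (- (q * B)) ^ s) * / qpoch q q s
    * ((1 - B) * qpoch (B * q) q s)); [ring | rewrite H; ring].
Qed.

(** The terms at [B] and those at [B * q] differ by a discrete derivative: this is
    what makes their sum [G] satisfy [G(B) = (1 - B) G(Bq)]. *)
Lemma poised_telescope (B : C) (s : nat) :
  (1 - B) * poised_term q (B * q) s
  = poised_term q B s
    + ((1 - q ^ S s) * poised_core q B (S s) - (1 - q ^ s) * poised_core q B s).
Proof.
  unfold poised_term. rewrite Cmult_assoc, poised_core_shift, poised_core_S.
  replace (2 * s)%nat with (s + s)%nat by lia. rewrite Cpow_add_r. ring.
Qed.

(** Dominates [poised_core q B s] uniformly in [Cmod B <= M]: the numerator factors
    are bounded by [1 + M], the denominator factors from below by [1 - Cmod q]. *)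
Definition majorant (M : R) (s : nat) : R :=
  (Cmod q ^ (3 * binom2 s) * (M * (1 + M) / (1 - Cmod q)) ^ s)%R.

Lemma majorant_gt0 (M : R) (s : nat) : (0 < M)%R -> (0 < majorant M s)%R.
Proof.
  intros HM. apply Rmult_lt_0_compat; apply pow_lt; [tauto|].
  apply Rdiv_lt_0_compat; [apply Rmult_lt_0_compat|]; lra.
Qed.

(** The quadratic exponent beats every geometric growth: consecutive ratios are
    [K * Cmod q ^ (3 s)], which tend to [0]. *)
Lemma ex_series_majorant (M : R) : (0 < M)%R -> ex_series (majorant M).
Proof.
  intros HM.
  set (K := (M * (1 + M) / (1 - Cmod q))%R).
  assert (HK : (0 < K)%R).
  { unfold K. apply Rdiv_lt_0_compat; [apply Rmult_lt_0_compat|]; lra. }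
  assert (Hpos : forall s, (0 < majorant M s)%R) by (intros s; apply majorant_gt0, HM).
  apply (ex_series_ext (fun s => Rabs (majorant M s))).
  { intros s. apply Rabs_pos_eq, Rlt_le, Hpos. }
  apply (ex_series_DAlembert _ 0 Rlt_0_1).
  - intros s. specialize (Hpos s). lra.
  - apply (is_lim_seq_ext (fun s => (Cmod q ^ 3) ^ s * K)%R).
    + intros s. rewrite Rabs_pos_eq.
      * unfold majorant. fold K.
        replace (3 * binom2 (S s))%nat with (3 * s + 3 * binom2 s)%nat
          by (rewrite binom2_S; lia).
        rewrite pow_add, pow_mult. simpl.
        pose proof (pow_lt K s HK).
        pose proof (pow_lt (Cmod q) (3 * binom2 s) (proj1 Hq)).
        simpl in *. field. lra.
      * apply Rlt_le, Rdiv_lt_0_compat; apply Hpos.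
    + replace (Finite 0) with (Rbar_mult 0 K) by (simpl; f_equal; ring).
      apply is_lim_seq_mult'; [|apply is_lim_seq_const].
      apply is_lim_seq_geom. rewrite Rabs_pos_eq by (apply pow_le; lra).
      apply pow_lt_1_compat; [lra | lia].
Qed.

Lemma Cmod_pow_le1 (k : nat) : (0 <= Cmod q ^ k <= 1)%R.
Proof.
  split; [apply pow_le; lra |].
  rewrite <- (pow1 k). apply pow_incr. lra.
Qed.

Lemma Cmod_one_minus_le (B : C) (M : R) (k : nat) :
  (Cmod B <= M)%R -> (Cmod (1 - B * q ^ k) <= 1 + M)%R.
Proof.
  intros H. unfold Cminus. eapply Rle_trans; [apply Cmod_triangle|].
  rewrite Cmod_opp, Cmod_mult, Cmod_pow, Cmod_1.
  pose proof (Cmod_pow_le1 k). pose proof (Cmod_ge_0 B). nra.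
Qed.

Lemma Cmod_qq_le (s : nat) : ((1 - Cmod q) ^ s <= Cmod (qpoch q q s))%R.
Proof.
  induction s as [|s IH]; simpl.
  - rewrite Cmod_1. lra.
  - rewrite Cmod_mult.
    assert (H : (1 - Cmod q <= Cmod (1 - q * q ^ s))%R).
    { pose proof (Cmod_triangle (1 - q * q ^ s) (q * q ^ s)) as T.
      replace (1 - q * q ^ s + q * q ^ s) with (RtoC 1) in T by ring.
      rewrite Cmod_1, Cmod_mult, Cmod_pow in T.
      pose proof (Cmod_pow_le1 s). nra. }
    assert (0 <= (1 - Cmod q) ^ s)%R by (apply pow_le; lra).
    rewrite Rmult_comm. apply Rmult_le_compat; lra.
Qed.

Lemma Cmod_qpoch_le (B : C) (M : R) (s : nat) :
  (Cmod B <= M)%R -> (Cmod (qpoch B q s) <= (1 + M) ^ s)%R.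
Proof.
  intros H. induction s as [|s IH]; simpl.
  - rewrite Cmod_1. lra.
  - rewrite Cmod_mult, Rmult_comm.
    apply Rmult_le_compat; auto using Cmod_ge_0, Cmod_one_minus_le.
Qed.

(** The factor [eps ^ s] is kept apart because it is what makes all the terms but
    the first negligible when [B] is replaced by [B * q ^ N] with [N] large. *)
Lemma Cmod_poised_core_le (B : C) (M eps : R) (s : nat) :
  (0 < M)%R -> (0 <= eps <= 1)%R -> (Cmod B <= eps * M)%R ->
  (Cmod (poised_core q B s) <= eps ^ s * majorant M s)%R.
Proof.
  intros HM He HB.
  assert (HBR : (Cmod B <= M)%R) by nra.
  pose proof (Cmod_qpoch_le B M s HBR) as H1.
  pose proof (Cmod_qq_le s) as H2.
  assert (H3 : (0 < (1 - Cmod q) ^ s)%R) by (apply pow_lt; lra).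
  unfold poised_core, majorant.
  rewrite Cmod_div by apply qq_neq0.
  rewrite !Cmod_mult, !Cmod_pow, Cmod_opp, Cmod_mult.
  assert (H4 : ((Cmod q * Cmod B) ^ s <= eps ^ s * M ^ s)%R).
  { rewrite <- Rpow_mult_distr. apply pow_incr. pose proof (Cmod_ge_0 B).
    split; nra. }
  assert (H0 : (0 <= (Cmod q * Cmod B) ^ s)%R).
  { apply pow_le. pose proof (Cmod_ge_0 B). nra. }
  assert (H5 : (/ Cmod (qpoch q q s) <= / (1 - Cmod q) ^ s)%R)
    by (apply Rinv_le_contravar; assumption).
  pose proof (Cmod_pow_le1 (3 * binom2 s)) as H6.
  unfold Rdiv.
  rewrite (Rpow_mult_distr _ (/ (1 - Cmod q))), (Rpow_mult_distr M), pow_inv.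
  replace (eps ^ s * (Cmod q ^ (3 * binom2 s)
    * (M ^ s * (1 + M) ^ s * / (1 - Cmod q) ^ s)))%R
    with (Cmod q ^ (3 * binom2 s) * (eps ^ s * M ^ s) * (1 + M) ^ s * / (1 - Cmod q) ^ s)%R
    by ring.
  assert (0 <= Cmod (qpoch B q s))%R by apply Cmod_ge_0.
  assert (0 <= / Cmod (qpoch q q s))%R.
  { apply Rlt_le, Rinv_0_lt_compat. lra. }
  apply Rmult_le_compat; auto.
  - apply Rmult_le_pos; auto. apply Rmult_le_pos; tauto.
  - apply Rmult_le_compat; auto.
    + apply Rmult_le_pos; tauto.
    + apply Rmult_le_compat_l; tauto.
Qed.

Lemma Cmod_poised_term_le (B : C) (M eps : R) (s : nat) :
  (0 < M)%R -> (0 <= eps <= 1)%R -> (Cmod B <= eps * M)%R ->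
  (Cmod (poised_term q B s) <= eps ^ s * ((1 + M) * majorant M s))%R.
Proof.
  intros HM He HB. unfold poised_term. rewrite Cmod_mult.
  replace (eps ^ s * ((1 + M) * majorant M s))%R
    with (eps ^ s * majorant M s * (1 + M))%R by ring.
  apply Rmult_le_compat; try apply Cmod_ge_0.
  - apply Cmod_poised_core_le; auto.
  - apply Cmod_one_minus_le. nra.
Qed.

Lemma core_boundary_vanishes (B : C) :
  filterlim (fun s => (1 - q ^ s) * poised_core q B s) eventually
    (@locally C_NormedModule (RtoC 0)).
Proof.
  apply (@filterlim_norm_zero nat C_AbsRing C_NormedModule eventually _).
  apply (is_lim_seq_le_le (fun _ => 0%R) _
           (fun s => 2 * majorant (Cmod B + 1) s)%R 0).
  - intros s. change (0 <= Cmod ((1 - q ^ s) * poised_core q B s)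
      <= 2 * majorant (Cmod B + 1) s)%R.
    split; [apply Cmod_ge_0|]. rewrite Cmod_mult.
    pose proof (Cmod_ge_0 B) as HB.
    assert (H1 : (Cmod (1 - q ^ s) <= 2)%R).
    { replace (q ^ s) with (1 * q ^ s) by ring. replace 2%R with (1 + 1)%R by ring.
      apply Cmod_one_minus_le. rewrite Cmod_1. lra. }
    assert (H2 := Cmod_poised_core_le B (Cmod B + 1) 1 s ltac:(lra) ltac:(lra) ltac:(lra)).
    rewrite pow1, Rmult_1_l in H2.
    apply Rmult_le_compat; auto using Cmod_ge_0.
  - apply is_lim_seq_const.
  - apply ex_series_lim_0. apply (ex_series_scal_l (K := R_AbsRing) (V := R_NormedModule) 2%R).
    apply ex_series_majorant. pose proof (Cmod_ge_0 B). lra.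
Qed.

(** A common factor [c] is carried along so that the step can be iterated
    without dividing by factors [1 - B * q ^ j], which may vanish. *)
Lemma poised_series_shift (B c l : C) :
  Cseries (fun s => c * poised_term q B s) l ->
  Cseries (fun s => c * (1 - B) * poised_term q (B * q) s) l.
Proof.
  intros H.
  pose proof (is_series_telescope _ (core_boundary_vanishes B)) as T. simpl in T.
  apply (Cseries_scal c) in T.
  replace l with (l + c * - ((1 - 1) * poised_core q B 0)) by ring.
  eapply is_series_ext; [|exact (Cseries_plus _ _ _ _ H T)].
  intros s. cbv beta. rewrite <- Cmult_assoc, poised_telescope. rewrite !Cpow_S.
  C_eq. ring.
Qed.

Lemma poised_series_shift_n (B l : C) (N : nat) :
  Cseries (poised_term q B) l ->
  Cseries (fun s => qpoch B q N * poised_term q (B * q ^ N) s) l.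
Proof.
  intros H. induction N as [|N IH].
  - eapply is_series_ext; [|exact H]. intros s. simpl. rewrite Cmult_1_r, Cmult_1_l.
    reflexivity.
  - replace (B * q ^ S N) with (B * q ^ N * q) by (rewrite Cpow_S; ring).
    exact (poised_series_shift _ _ _ IH).
Qed.

Lemma ex_poised_series (B : C) : exists l, Cseries (poised_term q B) l.
Proof.
  pose proof (Cmod_ge_0 B) as HB.
  apply (ex_series_le (V := C_CompleteNormedModule) (poised_term q B)
           (fun s => (1 + (Cmod B + 1)) * majorant (Cmod B + 1) s)%R).
  - intros s.
    pose proof (Cmod_poised_term_le B (Cmod B + 1) 1 s ltac:(lra) ltac:(lra) ltac:(lra)) as H.
    rewrite pow1, Rmult_1_l in H. exact H.
  - apply (ex_series_scal_l (K := R_AbsRing) (V := R_NormedModule)). apply ex_series_majorant. lra.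
Qed.

(** After [N] shifts the sum is [(B;q)_N] times a series in [B * q ^ N], whose
    terms other than the leading [1] are of order [q ^ N]. *)
Lemma qpoch_tail_bound (B l : C) :
  Cseries (poised_term q B) l ->
  exists c : R, (0 < c)%R /\
    forall N, (Cmod (l - qpoch B q N) <= Cmod (qpoch B q N) * (c * Cmod q ^ N))%R.
Proof.
  intros H. pose proof (Cmod_ge_0 B) as HB.
  set (M := (Cmod B + 1)%R).
  assert (HM : (0 < M)%R) by (unfold M; lra).
  assert (Hmaj : forall s, (0 <= majorant M s)%R)
    by (intros s; apply Rlt_le, majorant_gt0, HM).
  destruct (ex_series_majorant M HM) as [S HS].
  assert (HS0 : (0 <= S)%R).
  { change (Rbar_le 0%R S).
    apply (is_lim_seq_le (fun _ => 0%R) (sum_n (majorant M))).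
    - intros n. apply (Rle_trans _ (sum_n (fun _ => 0%R) n)).
      + rewrite sum_n_const. lra.
      + apply sum_n_m_le. exact Hmaj.
    - apply is_lim_seq_const.
    - exact HS. }
  exists ((1 + M) * S + M)%R. split; [nra|].
  intros N.
  pose proof (poised_series_shift_n B l N H) as HN.
  set (P := qpoch B q N) in *. set (B' := B * q ^ N) in *. set (eps := (Cmod q ^ N)%R).
  pose proof (Cmod_pow_le1 N) as He. fold eps in He.
  assert (HB' : (Cmod B' <= eps * M)%R).
  { unfold B', eps, M. rewrite Cmod_mult, Cmod_pow. fold eps. nra. }
  (* the term of index [0] is [1 - B'], hence the correction [- (P * B')] *)
  replace (l - P) with ((l - P * poised_term q B' 0) + - (P * B')).
  2:{ unfold poised_term, poised_core; simpl. field. }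
  eapply Rle_trans; [apply Cmod_triangle|].
  rewrite Cmod_opp, (Cmod_mult P B').
  pose proof (Cmod_ge_0 P) as HP.
  enough (E : (Cmod (l - P * poised_term q B' 0) <= Cmod P * (eps * (1 + M)) * S)%R) by nra.
  (* the whole tail is dominated termwise by [eps] times the majorant, since each
     of its terms carries at least one factor [B'] *)
  apply (Cmod_series_le (fun s => match s with O => 0 | S _ => P * poised_term q B' s end)
           (fun s => Cmod P * (eps * (1 + M)) * majorant M s)%R).
  - intros [|s].
    + rewrite Cmod_0. apply Rmult_le_pos; [apply Rmult_le_pos; [lra|nra]|].
      apply Hmaj.
    + rewrite Cmod_mult, !Rmult_assoc. apply Rmult_le_compat_l; [lra|].
      eapply Rle_trans; [apply (Cmod_poised_term_le B' M eps); auto|].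
      simpl pow. rewrite Rmult_assoc. apply Rmult_le_compat_l; [lra|].
      rewrite <- (Rmult_1_l ((1 + M) * majorant M (Datatypes.S s))) at 2.
      apply Rmult_le_compat_r.
      * apply Rmult_le_pos; [lra|]. apply Hmaj.
      * rewrite <- (pow1 s). apply pow_incr. lra.
  - apply (is_series_decr_1 (V := C_NormedModule)).
    apply (is_series_incr_1 (V := C_NormedModule) (fun s => P * poised_term q B' s)).
    match goal with |- is_series _ ?x => replace x with l; [exact HN|] end.
    change (l = l - P * poised_term q B' 0 + - 0 + P * poised_term q B' 0). ring.
  - exact (is_series_scal (K := R_AbsRing) (V := R_NormedModule) _ _ _ HS).
Qed.

(** The bound of [qpoch_tail_bound] is relative to [(B;q)_N] itself.  As soon as
    [c * Cmod q ^ N <= 1 / 2] it forces [Cmod (qpoch B q N) <= 2 * Cmod l], and then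
    becomes absolute. *)
Lemma qpoch_filterlim (B l : C) :
  Cseries (poised_term q B) l ->
  filterlim (qpoch B q) eventually (@locally C_NormedModule l).
Proof.
  intros H. destruct (qpoch_tail_bound B l H) as [c [Hc HN]].
  apply (filterlim_locally_ball_norm (K := C_AbsRing) (U := C_NormedModule)).
  intros eps. pose proof (cond_pos eps) as He. pose proof (Cmod_ge_0 l) as Hl.
  (* the bound [1 / 2] absorbs [qpoch B q N] into [l]; the other one gives [eps] *)
  set (d := Rmin (1 / 2) (eps / (2 * (Cmod l + 1)))).
  assert (Hd : (0 < d)%R).
  { apply Rmin_glb_lt; [lra|]. apply Rdiv_lt_0_compat; lra. }
  destruct (pow_lt_1_zero (Cmod q)) with (y := (d / c)%R) as [N0 HN0].
  { rewrite Rabs_pos_eq; lra. }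
  { apply Rdiv_lt_0_compat; lra. }
  exists N0. intros N HNN.
  change (Cmod (qpoch B q N - l) < eps)%R.
  specialize (HN N). specialize (HN0 N HNN).
  pose proof (Cmod_pow_le1 N) as H1. rewrite Rabs_pos_eq in HN0 by tauto.
  assert (Hy : (c * Cmod q ^ N < d)%R).
  { apply (Rmult_lt_compat_l c) in HN0; [|lra].
    replace (c * (d / c))%R with d in HN0 by (field; lra). exact HN0. }
  set (y := (c * Cmod q ^ N)%R) in *.
  assert (Hy0 : (0 <= y)%R) by (apply Rmult_le_pos; lra).
  assert (Hd1 : (d <= 1 / 2)%R) by apply Rmin_l.
  assert (Hd2 : (d <= eps / (2 * (Cmod l + 1)))%R) by apply Rmin_r.
  replace (qpoch B q N - l) with (- (l - qpoch B q N)) by ring. rewrite Cmod_opp.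
  pose proof (Cmod_triangle l (- (l - qpoch B q N))) as T.
  replace (l + - (l - qpoch B q N)) with (qpoch B q N) in T by ring.
  rewrite Cmod_opp in T.
  pose proof (Cmod_ge_0 (qpoch B q N)) as HP.
  assert (HP2 : (Cmod (qpoch B q N) <= 2 * Cmod l)%R) by nra.
  assert (Hf : (2 * (Cmod l + 1) * d <= eps)%R).
  { apply (Rmult_le_compat_l (2 * (Cmod l + 1))) in Hd2; [|lra].
    replace (2 * (Cmod l + 1) * (eps / (2 * (Cmod l + 1))))%R with (pos eps) in Hd2
      by (field; lra). exact Hd2. }
  nra.
Qed.

(** The limiting case of Rogers' very-well-poised 6-phi-5 sum. *)
Lemma poised_series (B : C) : Cseries (poised_term q B) (qpoch_inf B q).
Proof.
  destruct (ex_poised_series B) as [l Hl].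
  replace (qpoch_inf B q) with l; [exact Hl|]. symmetry.
  apply (iota_filterlim_locally (V := C_CompleteNormedModule) (F := eventually)).
  exact (qpoch_filterlim B l Hl).
Qed.

Lemma qpoch_inf_shift (B : C) :
  (1 - B) * qpoch_inf (B * q) q = qpoch_inf B q.
Proof.
  pose proof (poised_series_shift_n B _ 1 (poised_series B)) as H1.
  pose proof (Cseries_scal (1 - B) _ _ (poised_series (B * q))) as H2.
  apply (Cseries_unique _ _ _ H2).
  eapply is_series_ext; [|exact H1]. intros s. simpl.
  C_eq.
  rewrite !Cmult_1_r, Cmult_1_l. reflexivity.
Qed.

End Terms.

(** * Moments and orthogonality on the lattice *)

Section Lattice.

Variables (q a : C).
Hypotheses (Hq : (0 < Cmod q < 1)%R) (Ha : a <> 0)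
  (HA : forall k, 1 - / a ^ 2 * q ^ k <> 0).

Let A := / a ^ 2.

(** The orthogonality measure sits at [z = a q^(-m)], where [a / z = q ^ m], so that
    the basis element of index [k] vanishes at the first [k] nodes. *)
Definition node (m : nat) : C := / (q ^ m) * a.

(** Multiplication by the next basis factors, at a node, turns the terms with
    parameter [B] into those with parameter [B q^2], up to a shift of the index. *)
Lemma poised_core_lower (B : C) (s : nat) :
  B <> 0 ->
  poised_core q B (S s) * ((1 - q ^ S s) * (1 - / B * / q ^ S s))
  = (1 - B) * (1 - B * q) * poised_core q (B * q * q) s.
Proof.
  intros HB.
  pose proof (base_neq0 q Hq) as Hq0. pose proof (Cpow_nz q s Hq0) as Hqs.
  pose proof (poised_core_S q Hq B s) as H1.
  pose proof (poised_core_shift q B s) as H2.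
  pose proof (poised_core_shift q (B * q) s) as H3.
  transitivity ((1 - q ^ S s) * poised_core q B (S s) * (1 - / B * / q ^ S s)); [ring|].
  rewrite H1, <- (Cmult_assoc (1 - B)), H3.
  transitivity (q ^ s * (1 - B * q * q ^ s) * ((1 - B) * poised_core q (B * q) s)); [|ring].
  rewrite H2, Cpow_S. generalize dependent (q ^ s). intros. field. auto.
Qed.

Lemma poised_core_basis (k s : nat) :
  poised_core q A (k + s) * askey_basis a (node (k + s)) (/ q) k
  = qpoch A q (2 * k) * poised_core q (A * q ^ (2 * k)) s.
Proof.
  pose proof (base_neq0 q Hq) as Hq0.
  assert (HA0 : A <> 0).
  { unfold A. apply Cmod_gt_0. rewrite Cmod_inv by (apply Cpow_nz; auto).
    apply Rinv_0_lt_compat, Cmod_gt_0, Cpow_nz; auto. }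
  revert s. induction k as [|k IH]; intros s.
  - unfold askey_basis; simpl. replace (A * 1) with A by ring. ring.
  - replace (S k + s)%nat with (k + S s)%nat by lia.
    replace (2 * S k)%nat with (S (S (2 * k))) by lia.
    pose proof (poised_core_lower (A * q ^ (2 * k)) s
                  (Cmult_neq_0 _ _ HA0 (Cpow_nz _ _ Hq0))) as L.
    rewrite !qpoch_S.
    replace (A * q ^ S (S (2 * k))) with (A * q ^ (2 * k) * q * q)
      by (rewrite !Cpow_S; ring).
    replace (A * q ^ S (2 * k)) with (A * q ^ (2 * k) * q) by (rewrite Cpow_S; ring).
    transitivity (qpoch A q (2 * k)
      * ((1 - A * q ^ (2 * k)) * (1 - A * q ^ (2 * k) * q)
         * poised_core q (A * q ^ (2 * k) * q * q) s)); [|ring].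
    rewrite <- L, Cmult_assoc, <- IH.
    unfold askey_basis. rewrite !qpoch_S.
    replace (a * node (k + S s) * (/ q) ^ k) with (/ (A * q ^ (2 * k)) * / q ^ S s).
    2:{ unfold node, A. replace (2 * k)%nat with (k + k)%nat by lia.
        rewrite !Cpow_add_r, Cpow_inv by exact Hq0.
        pose proof (Cpow_nz q k Hq0). pose proof (Cpow_nz q (S s) Hq0).
        generalize dependent (q ^ S s). generalize dependent (q ^ k). intros.
        field. auto. }
    replace (a * / node (k + S s) * (/ q) ^ k) with (q ^ S s).
    2:{ unfold node. rewrite !Cpow_add_r, Cpow_inv by exact Hq0.
        pose proof (Cpow_nz q k Hq0). pose proof (Cpow_nz q (S s) Hq0).
        generalize dependent (q ^ S s). generalize dependent (q ^ k). intros.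
        field. auto. }
    ring.
Qed.

(** The weight times a basis element is again a weight, with parameter [A q^(2k)]
    and starting at index [k]. *)
Lemma poised_term_basis (k s : nat) :
  poised_term q A (k + s) * askey_basis a (node (k + s)) (/ q) k
  = qpoch A q (2 * k) * poised_term q (A * q ^ (2 * k)) s.
Proof.
  unfold poised_term. rewrite Cmult_assoc, <- poised_core_basis.
  replace (2 * (k + s))%nat with (2 * k + 2 * s)%nat by lia. rewrite Cpow_add_r. ring.
Qed.

Lemma askey_basis_node_0 (k m : nat) :
  (m < k)%nat -> askey_basis a (node m) (/ q) k = 0.
Proof.
  pose proof (base_neq0 q Hq) as Hq0. pose proof (Cpow_nz q m Hq0) as Hm.
  unfold askey_basis. intros H.
  replace (qpoch (a * / node m) (/ q) k) with (RtoC 0); [ring|].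
  induction H as [|k H IH]; simpl.
  - unfold node. rewrite Cpow_inv by exact Hq0.
    replace (a * / (/ q ^ m * a) * / q ^ m) with (RtoC 1) by (field; auto). ring.
  - rewrite <- IH. ring.
Qed.

(** All basis elements have the same moment: by [poised_term_basis] the sum
    over [m >= k] is the one reached from [k = 0] after [2k] shifts, and shifts
    preserve the value of the sum. *)
Lemma basis_moment (k : nat) :
  Cseries (fun m => poised_term q A m / (1 - A) * askey_basis a (node m) (/ q) k)
    (qpoch_inf (A * q) q).
Proof.
  assert (H1 : 1 - A <> 0).
  { specialize (HA 0%nat). simpl in HA. rewrite Cmult_1_r in HA. exact HA. }
  replace (qpoch_inf (A * q) q) with (/ (1 - A) * qpoch_inf A q).
  2:{ rewrite <- (qpoch_inf_shift q Hq A). field. exact H1. }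
  eapply (is_series_ext (V := C_NormedModule)
    (fun m => / (1 - A) * (poised_term q A m * askey_basis a (node m) (/ q) k))).
  { intros m. C_eq. field. exact H1. }
  apply Cseries_scal. apply (Cseries_skip _ _ k).
  - intros m Hm. rewrite askey_basis_node_0 by exact Hm. ring.
  - eapply is_series_ext; [|exact (poised_series_shift_n q Hq A _ (2 * k) (poised_series q Hq A))].
    intros s. symmetry. exact (poised_term_basis k s).
Qed.

Lemma inv_base_qpoch_neq0 (k : nat) : qpoch (/ q) (/ q) k <> 0.
Proof.
  pose proof (base_neq0 q Hq) as Hq0.
  apply qpoch_neq0. intros j. rewrite <- Cpow_S, Cpow_inv by exact Hq0.
  intros E. apply (one_minus_pow_neq0 q j (proj2 Hq)).
  pose proof (Cpow_nz q (S j) Hq0) as Hj.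
  replace (1 - q ^ S j) with (- q ^ S j * (1 - / q ^ S j)) by (field; exact Hj).
  rewrite E. ring.
Qed.

Lemma node_neq0 (m : nat) : node m <> 0.
Proof.
  pose proof (Cpow_nz q m (base_neq0 q Hq)) as Hm.
  intros E. apply Ha. replace a with (q ^ m * node m) by (unfold node; field; exact Hm).
  rewrite E. ring.
Qed.

Lemma inv_base_neq0 : / q <> 0.
Proof.
  pose proof (base_neq0 q Hq) as Hq0. intros E. apply C1_nz.
  rewrite <- (Cinv_l q Hq0), E. ring.
Qed.

Definition herm (n m : nat) : C := big_Hermite n (node m) a (/ q).

Definition weight (m : nat) : C := poised_term q A m / (1 - A).

(** By [basis_moment] the functional evaluates every basis element at the same
    value, so it only sees the sum of the coefficients. *)
Lemma herm_mean (n : nat) :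
  Cseries (fun m => weight m * herm n m) (qpoch_inf (A * q) q * kdelta n 0).
Proof.
  assert (H : forall N,
    Cseries (fun m => weight m * partial_Hermite a (node m) (/ q) n N)
      (sum_n (fun k => big_coeff (/ q) n k) N * qpoch_inf (A * q) q)).
  { induction N as [|N IH].
    - rewrite sum_C_0.
      eapply is_series_ext; [|exact (Cseries_scal (big_coeff (/ q) n 0) _ _ (basis_moment 0))].
      intros m. C_eq.
      unfold partial_Hermite. rewrite sum_C_0. unfold weight. ring.
    - rewrite sum_C_S, Cmult_plus_distr_r.
      eapply is_series_ext; [|exact (Cseries_plus _ _ _ _ IH
        (Cseries_scal (big_coeff (/ q) n (S N)) _ _ (basis_moment (S N))))].
      intros m. C_eq.
      unfold partial_Hermite. rewrite sum_C_S. unfold weight. ring. }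
  specialize (H n). apply (Cseries_scal (/ a ^ n)) in H.
  replace (qpoch_inf (A * q) q * kdelta n 0)
    with (/ a ^ n * (sum_n (fun k => big_coeff (/ q) n k) n * qpoch_inf (A * q) q)).
  - eapply is_series_ext; [|exact H].
    intros m. C_eq.
    unfold herm.
    rewrite (big_Hermite_partial a (node m) (/ q) inv_base_neq0 n n) by lia. ring.
  - destruct n as [|n].
    + rewrite sum_C_0. unfold big_coeff, kdelta; simpl. field.
    + rewrite (sum_big_coeff_S (/ q) inv_base_neq0 inv_base_qpoch_neq0).
      unfold kdelta; simpl. ring.
Qed.

(** The squared norms, up to the total mass [(qA;q)_oo]. *)
Definition herm_norm (n : nat) : C := / q ^ binom2 n / (- q) ^ n * qpoch q q n.

Lemma herm_norm_S (n : nat) : herm_norm (S n) = (1 - (/ q) ^ S n) * herm_norm n.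
Proof.
  pose proof (base_neq0 q Hq) as Hq0.
  unfold herm_norm. rewrite binom2_S, Cpow_add_r, Cpow_inv by exact Hq0.
  simpl qpoch. rewrite !Cpow_S.
  assert (Hm : - q <> 0).
  { intros E. apply Hq0. replace q with (- - q) by ring. rewrite E. ring. }
  pose proof (Cpow_nz q n Hq0). pose proof (Cpow_nz (- q) n Hm).
  pose proof (Cpow_nz q (binom2 n) Hq0).
  generalize dependent (q ^ binom2 n). generalize dependent ((- q) ^ n).
  generalize dependent (q ^ n). intros. field. auto.
Qed.

(** Induction on [n'].  Using the recurrence twice, multiplication by [z + 1/z] is
    moved from [H_n'] to [H_n], which expresses the moment at [(n, n' + 1)] through
    those at [(n + 1, n')], [(n, n')], [(n - 1, n')] and [(n, n' - 1)]. *)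
Lemma herm_orthogonality (n' n : nat) :
  Cseries (fun m => weight m * herm n m * herm n' m)
    (qpoch_inf (A * q) q * herm_norm n * kdelta n n').
Proof.
  pose proof (base_neq0 q Hq) as Hq0.
  set (Q := qpoch_inf (A * q) q).
  set (P := fun n' => forall n, Cseries (fun m => weight m * herm n m * herm n' m)
    (Q * herm_norm n * kdelta n n')).
  (* the recurrence reaches back to [n' - 1], so two consecutive values are carried *)
  enough (H : P n' /\ P (pred n')) by exact (proj1 H n).
  clear n. induction n' as [|n' [IH1 IH0]].
  - assert (H0 : P 0%nat); [|split; exact H0].
    intros n. replace (Q * herm_norm n * kdelta n 0) with (Q * kdelta n 0).
    + eapply is_series_ext; [|exact (herm_mean n)].
      intros m. C_eq.
      replace (herm 0 m) with (RtoC 1); [ring|].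
      unfold herm, big_Hermite. rewrite sum_C_0. simpl. field.
    + destruct n as [|n]; unfold kdelta; simpl; [|ring].
      unfold herm_norm; simpl. field.
  - split; [|exact IH1]. intros n.
    set (p := / q) in *.
    pose proof (Cseries_plus _ _ _ _ (IH1 (S n))
      (Cseries_plus _ _ _ _ (Cseries_scal (a * (p ^ n - p ^ n')) _ _ (IH1 n))
        (Cseries_plus _ _ _ _ (Cseries_scal (1 - p ^ n) _ _ (IH1 (pred n)))
          (Cseries_scal (- (1 - p ^ n')) _ _ (IH0 n))))) as H.
    match type of H with is_series _ ?v =>
      replace (Q * herm_norm n * kdelta n (S n')) with v end.
    + eapply is_series_ext; [|exact H].
      intros m. C_eq. cbv beta.
      pose proof (big_Hermite_recurrence a (node m) p Ha (node_neq0 m) inv_base_neq0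
                    inv_base_qpoch_neq0) as R.
      pose proof (R n) as R1. pose proof (R n') as R2. fold p in R1, R2.
      change (big_Hermite ?k (node m) a p) with (herm k m) in R1, R2.
      replace (herm (S n) m) with ((node m + / node m) * herm n m
        - a * p ^ n * herm n m - (1 - p ^ n) * herm (pred n) m) by (rewrite R1; ring).
      replace (herm (S n') m) with ((node m + / node m) * herm n' m
        - a * p ^ n' * herm n' m - (1 - p ^ n') * herm (pred n') m) by (rewrite R2; ring).
      ring.
    + assert (Hn : forall k, (1 - p ^ S k) * herm_norm k = herm_norm (S k))
        by (intros k; symmetry; apply herm_norm_S).
      rewrite <- (Hn n). unfold kdelta.
      destruct (Nat.eqb_spec (S n) n') as [E1|E1];
        destruct (Nat.eqb_spec n n') as [E2|E2];
        destruct (Nat.eqb_spec (pred n) n') as [E3|E3];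
        destruct (Nat.eqb_spec n (pred n')) as [E4|E4];
        destruct (Nat.eqb_spec n (S n')) as [E5|E5]; try lia;
        try subst n'; try subst n; simpl pred in *; try ring.
      (* [pred n = n = n'] only at [n = 0], where both coefficients [1 - p ^ n] vanish *)
      * replace n with O by lia. simpl. ring.
      * destruct n as [|n]; [lia|]. simpl pred. rewrite <- (Hn n). ring.
Qed.

(** The quotient [(qA;q)_(2m) / (A;q)_(2m)] collapses to
    [(1 - A q^(2m)) / (1 - A)], the very-well-poised factor. *)
Lemma weight_qpoch (m : nat) :
  q ^ (3 * binom2 m) * (- (q / a ^ 2)) ^ m
  * ((qpoch (q / a ^ 2) q (2 * m) * qpoch (1 / a ^ 2) q m)
     / (qpoch (1 / a ^ 2) q (2 * m) * qpoch q q m))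
  = weight m.
Proof.
  replace (q / a ^ 2) with (A * q) by (unfold A, Cdiv; ring).
  replace (1 / a ^ 2) with A by (unfold A, Cdiv; ring).
  pose proof (qpoch_shift A q (2 * m)) as H. rewrite qpoch_S in H.
  pose proof (HA 0) as H1. simpl in H1. rewrite Cmult_1_r in H1.
  pose proof (qpoch_neq0 A q HA (2 * m)) as H2.
  pose proof (qq_neq0 q Hq m) as H3.
  unfold weight, poised_term, poised_core.
  replace (- (q * A)) with (- (A * q)) by ring.
  replace (qpoch (A * q) q (2 * m))
    with (qpoch A q (2 * m) * (1 - A * q ^ (2 * m)) / (1 - A)).
  2:{ rewrite <- H. field. exact H1. }
  generalize dependent (qpoch A q (2 * m)). generalize (q ^ (2 * m)) (q ^ (3 * binom2 m)).
  intros. field. auto.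
Qed.

End Lattice.

Theorem theorem4p25 :
  forall (n n' : nat) (q a : C),
    (0 < Cmod q < 1)%R ->
    a <> 0 ->
    ~ Omega q (/ (a ^ 2)) ->
    @is_series C_AbsRing C_NormedModule
      (fun m : nat =>
         q ^ (3 * binom2 m) * (- (q / a ^ 2)) ^ m
         * ((qpoch (q / a ^ 2) q (2 * m) * qpoch (1 / a ^ 2) q m)
            / (qpoch (1 / a ^ 2) q (2 * m) * qpoch q q m))
         * big_Hermite n (/ (q ^ m) * a) a (/ q)
         * big_Hermite n' (/ (q ^ m) * a) a (/ q))
      (/ (q ^ binom2 n) / (- q) ^ n
       * qpoch_inf (q / a ^ 2) q * qpoch q q n * kdelta n n').
Proof.
  intros n n' q a Hq Ha HO.
  assert (HA : forall k, 1 - / a ^ 2 * q ^ k <> 0).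
  { intros k. apply Cminus_neq0. intros E. apply HO. exists k.
    pose proof (Cpow_nz q k (base_neq0 q Hq)) as Hk.
    replace (/ a ^ 2) with (/ a ^ 2 * q ^ k * / q ^ k).
    - rewrite <- E. ring.
    - field. split; [exact Ha | exact Hk]. }
  replace (/ q ^ binom2 n / (- q) ^ n * qpoch_inf (q / a ^ 2) q * qpoch q q n * kdelta n n')
    with (qpoch_inf (/ a ^ 2 * q) q * herm_norm q n * kdelta n n').
  - eapply is_series_ext; [|exact (herm_orthogonality q a Hq Ha HA n' n)].
    intros m. rewrite (weight_qpoch q a Hq HA m). reflexivity.
  - replace (q / a ^ 2) with (/ a ^ 2 * q) by (unfold Cdiv; ring).
    unfold herm_norm. ring.
Qed.
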